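(* Let $n\ge 1$ be an integer and let $m\ge 0$ be an integer. Then $$\sum_{d\mid n}d\sum_{k=0}^{m}L_k(d)=\frac{B_{n+1}(m+1)-B_{n+1}}{n+1},$$ where the outer sum runs over the positive divisors $d$ of $n$, $L_k(d)$ is the number of $k$-ary Lyndon words of length $d$, $B_{n+1}(x)$ denotes the Bernoulli polynomial and $B_{n+1}=B_{n+1}(0)$ the Bernoulli number.
   Context: For integers $k\ge 0$ and $n\ge 1$, the number of $k$-ary Lyndon words of length $n$ is given by $L_k(n)=\frac1n\sum_{d\mid n}\mu\left(\frac nd\right)k^d$, where $\mu$ is the Möbius function; this formula is taken as the definition of $L_k(n)$. The Bernoulli polynomials $B_n(x)$ are defined by $\frac{ue^{ux}}{e^{u}-1}=\sum_{n=0}^{\infty}B_n(x)\frac{u^n}{n!}$ for $|u|<2\pi$, and the Bernoulli numbers are $B_n=B_n(0)$. *)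

(* Defs.v *)
From mathcomp Require Export all_boot all_order all_algebra.
From mathcomp Require Export all_classical all_reals.
From mathcomp Require Export topology normedtype sequences exp trigo.

Set Implicit Arguments.
Unset Strict Implicit.
Unset Printing Implicit Defensive.

Import Order.TTheory GRing.Theory Num.Theory.
Import numFieldTopology.Exports numFieldNormedType.Exports.

Local Open Scope classical_set_scope.
Local Open Scope ring_scope.

Definition squarefree (n : nat) : bool :=
  (0 < n)%N && all (fun p => logn p n == 1%N) (primes n).

Definition moebius (n : nat) : int :=
  if squarefree n then (-1) ^+ size (primes n) else 0.

(* The value is taken in a field, so that the division by n is exact. *)
Definition lyndon (F : fieldType) (k n : nat) : F :=
  n%:R^-1 * \sum_(d <- divisors n) (moebius (n %/ d))%:~R * k%:R ^+ d.

(* B is the sequence of Bernoulli polynomials.  The point u = 0 is left out: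
   the generating function has a removable singularity there, whereas 0 / 0
   is 0 in the library.  Only real x and u are needed, since the expansion on
   a punctured real neighbourhood of 0 already determines every B n. *)
Definition bernoulli_polynomials (R : realType) (B : nat -> {poly R}) : Prop :=
  forall x u : R, u != 0 -> `|u| < 2 * pi ->
    series (fun n => (B n).[x] * (u ^+ n / n`!%:R)) @ \oo -->
      u * expR (u * x) / (expR u - 1).

Definition bernoulli_number (R : realType) (B : nat -> {poly R}) (n : nat) : R :=
  (B n).[0].

(* Main.v *)
(** Möbius inversion of the definition of [lyndon] gives
    [sum_(d | n) d * L_k(d) = k ^ n], so the left-hand side is the power sum
    [0 ^ n + ... + m ^ n].  Subtracting the generating functions at [x + 1] and
    at [x] leaves [u e^(ux)], and uniqueness of power series expansions yields
    [B_(n+1)(x + 1) - B_(n+1)(x) = (n + 1) x ^ n], which telescopes. *)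
Require Import Defs.

Import Order.TTheory GRing.Theory Num.Theory.
Import numFieldTopology.Exports numFieldNormedType.Exports.
Local Open Scope ring_scope.

Lemma moebius1 : moebius 1 = 1.
Proof. by []. Qed.

(** The new prime enters with exponent one, so squarefreeness is unaffected and the number of prime
    factors grows by one. *)
Lemma moebius_prime_mul (p d : nat) :
  prime p -> (0 < d)%N -> ~~ (p %| d)%N -> moebius (p * d) = - moebius d.
Proof.
move=> pp d0 pd.
have p0 := prime_gt0 pp.
have pNd : p \notin primes d by rewrite mem_primes pp d0.
have perm_pd : perm_eq (primes (p * d)) (p :: primes d).
  apply: uniq_perm; rewrite ?primes_uniq //= ?pNd ?primes_uniq // => q.
  by rewrite primesM // primes_prime // !inE.
have sq_pd : squarefree (p * d) = squarefree d.
  rewrite /squarefree muln_gt0 p0 d0 (perm_all _ perm_pd) /=.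
  rewrite lognM // logn_prime // eqxx lognE (negPf pd) !andbF eqxx /=.
  apply: eq_in_all => q qd; rewrite lognM // logn_prime //.
  by case: (q =P p) => [qp|//]; rewrite -qp qd in pNd.
rewrite /moebius sq_pd (perm_size perm_pd) /= exprS mulN1r.
by case: ifP; rewrite ?oppr0.
Qed.

Lemma moebius_square_dvd (p d : nat) :
  prime p -> (0 < d)%N -> (p ^ 2 %| d)%N -> moebius d = 0.
Proof.
move=> pp d0 p2d; rewrite /moebius; case: ifP => // /andP[_ /allP sq].
have /sq/eqP : p \in primes d by rewrite mem_primes pp d0 (dvdn_trans (dvdn_exp _ (dvdnn p)) p2d).
by move: p2d; rewrite pfactor_dvdn // => /[swap] ->.
Qed.

(** For [n != 1], fix a prime [p] dividing [n]. Divisors that are multiples of [p ^ 2] contribute 0;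
    the others pair off as [d] and [p * d] with [p] not dividing [d], and each pair cancels. *)
Lemma sum_moebius (n : nat) :
  (0 < n)%N -> \sum_(d <- divisors n) moebius d = (n == 1)%N%:R.
Proof.
move=> n0; have [->|n1] := eqVneq n 1%N; first by rewrite big_seq1.
have pp : prime (pdiv n) by rewrite pdiv_prime // ltn_neqAle eq_sym n1.
have pn := pdiv_dvd n; set p := pdiv n in pp pn.
have p0 := prime_gt0 pp.
pose S := [seq d <- divisors n | ~~ (p %| d)%N].
rewrite (bigID (fun d => (p %| d)%N)) /=.
rewrite (bigID (fun d => (p ^ 2 %| d)%N)) /= [X in X + _ + _]big1_seq; last first.
  move=> d /andP[/andP[_ p2d]]; rewrite -dvdn_divisors // => /(dvdn_gt0 n0) d0.
  exact: moebius_square_dvd pp d0 p2d.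
have pairing : perm_eq
    [seq d <- divisors n | (p %| d)%N && ~~ (p ^ 2 %| d)%N] [seq p * d | d <- S]%N.
  apply: uniq_perm; rewrite ?filter_uniq ?divisors_uniq //.
    rewrite map_inj_uniq ?filter_uniq ?divisors_uniq // => a b /eqP.
    by rewrite eqn_pmul2l // => /eqP.
  move=> d; rewrite mem_filter -dvdn_divisors //.
  apply/idP/mapP => [/andP[/andP[/dvdnP[e ->]]]|[e]].
    rewrite mulnC dvdn_pmul2l // => pe en; exists e => //.
    by rewrite mem_filter pe -dvdn_divisors // (dvdn_trans _ en) // dvdn_mull.
  rewrite mem_filter -dvdn_divisors // => /andP[pe en] ->.
  (* As [p] is coprime to [e] and both divide [n], so does [p * e]. *)
  by rewrite dvdn_mulr // dvdn_pmul2l // pe Gauss_dvd ?pn ?en // prime_coprime.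
rewrite add0r -big_filter (perm_big _ pairing) big_map -[X in _ + X]big_filter.
rewrite -big_split big1_seq // => d /andP[_].
rewrite mem_filter -dvdn_divisors // => /andP[pd /(dvdn_gt0 n0) d0].
by rewrite /= moebius_prime_mul // addNr.
Qed.

(** Put [d = e * c]: both sides run over the pairs [(e, c)] with [e * c] dividing [n]. *)
Lemma sum_divisors_exchange (V : nmodType) (F : nat -> nat -> V) (n : nat) :
  (0 < n)%N ->
  \sum_(d <- divisors n) \sum_(e <- divisors d) F (d %/ e)%N e =
  \sum_(e <- divisors n) \sum_(c <- divisors (n %/ e)) F c e.
Proof.
move=> n0.
transitivity (\sum_(d <- divisors n) \sum_(e <- divisors n | (e %| d)%N)
    F (d %/ e)%N e).
  apply: eq_big_seq => d; rewrite -dvdn_divisors // => dn.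
  have d0 := dvdn_gt0 n0 dn.
  rewrite -[RHS]big_filter; apply: perm_big.
  apply: uniq_perm; rewrite ?filter_uniq ?divisors_uniq // => e.
  rewrite mem_filter -!dvdn_divisors //.
  by case: (boolP (e %| d)%N) => // /dvdn_trans ->.
rewrite (exchange_big_dep xpredT) //=; apply: eq_big_seq => e.
rewrite -dvdn_divisors // => en; have e0 := dvdn_gt0 n0 en.
have ne0 : (0 < n %/ e)%N by rewrite divn_gt0 // dvdn_leq.
have multiples : perm_eq [seq d <- divisors n | (e %| d)%N]
    [seq e * c | c <- divisors (n %/ e)]%N.
  apply: uniq_perm; rewrite ?filter_uniq ?divisors_uniq //.
    rewrite map_inj_uniq ?divisors_uniq // => a b /eqP.
    by rewrite eqn_pmul2l // => /eqP.
  move=> d; rewrite mem_filter -dvdn_divisors //.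
  apply/idP/mapP => [/andP[/dvdnP[c ->] cn]|[c]].
    by exists c; rewrite 1?mulnC // -dvdn_divisors // dvdn_divRL.
  by rewrite -dvdn_divisors // dvdn_divRL // mulnC => cn ->; rewrite dvdn_mulr.
rewrite -big_filter (perm_big _ multiples) big_map.
by apply: eq_bigr => c _; rewrite mulKn.
Qed.

(** After the exchange, the coefficient of [k ^ e] is the sum of [moebius] over the divisors of
    [n / e], which vanishes unless [e = n]. *)
Lemma sum_lyndon (F : numFieldType) (k n : nat) :
  (0 < n)%N -> \sum_(d <- divisors n) d%:R * lyndon F k d = k%:R ^+ n.
Proof.
move=> n0.
transitivity (\sum_(d <- divisors n) \sum_(e <- divisors d)
    (moebius (d %/ e))%:~R * k%:R ^+ e : F).
  apply: eq_big_seq => d; rewrite -dvdn_divisors // => /(dvdn_gt0 n0) d0.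
  by rewrite /lyndon mulVKf // pnatr_eq0 -lt0n.
rewrite (@sum_divisors_exchange F (fun c e => (moebius c)%:~R * k%:R ^+ e)) //.
rewrite (bigD1_seq n) ?divisors_uniq ?divisors_id //= divnn n0 big_seq1.
rewrite moebius1 mul1r big1_seq ?addr0 // => e /andP[en].
rewrite -dvdn_divisors // => e_dvd; have e0 := dvdn_gt0 n0 e_dvd.
have ne1 : (n %/ e != 1)%N.
  by apply: contra en; rewrite eq_sym eqn_div // mul1n.
have ne0 : (0 < n %/ e)%N by rewrite divn_gt0 // dvdn_leq.
have sum0 : \sum_(c <- divisors (n %/ e)) ((moebius c)%:~R : F) = 0.
  by rewrite -mulrz_sumr sum_moebius // (negPf ne1).
by rewrite -big_distrl /= sum0 mul0r.
Qed.

Section PowerSeries.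
Local Open Scope classical_set_scope.
Variable R : realType.
Implicit Types (c : nat -> R) (r u x : R).

Lemma sum_geometric_le2 (t : R) (N : nat) :
  0 <= t -> t <= 2^-1 -> \sum_(0 <= k < N) t ^+ k <= 2.
Proof.
move=> t0 t2; elim: N => [|N IH]; first by rewrite big_geq.
rewrite big_nat_recl // expr0.
under eq_bigr do rewrite exprS.
rewrite -mulr_sumr.
have : t * \sum_(0 <= k < N) t ^+ k <= 2^-1 * 2.
  by apply: ler_pM => //; apply: sumr_ge0 => i _; apply: exprn_ge0.
by rewrite mulVf ?pnatr_eq0 // => /(lerD (lexx 1)).
Qed.

Lemma series_pseries_recl c u (N : nat) :
  series (fun k => c k * u ^+ k) N.+1 =
  c 0%N + u * series (fun k => c k.+1 * u ^+ k) N.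
Proof.
rewrite !seriesEnat /= big_nat_recl // expr0 mulr1 mulr_sumr.
by congr (_ + _); apply: eq_bigr => k _; rewrite exprS mulrCA.
Qed.

(** The point 0 is excluded, so [c 0] is reached as a limit. The terms at [s = r / 2] are bounded by
    some [M]; hence at [t * s] everything past the constant term is at most the sum of the
    [M * t ^ k.+1], thus at most [2 * M * t], which tends to 0 with [t]. *)
Lemma pseries_eq0_head c r : 0 < r ->
  (forall u, u != 0 -> `|u| < r ->
    series (fun k => c k * u ^+ k) @ \oo --> (0 : R)) ->
  c 0%N = 0.
Proof.
move=> r0 cvg0.
pose s := r / 2.
have s0 : 0 < s by rewrite divr_gt0.
have sr : `|s| < r by rewrite gtr0_norm // ltr_pdivrMr // ltr_pMr // ltr1n.
have terms0 : (fun k => c k * s ^+ k) @ \oo --> (0 : R).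
  by apply/cvg_series_cvg_0/cvg_ex; exists 0; apply: cvg0; rewrite ?gt_eqF.
have [M M0 terms_le] : exists2 M : R, 0 < M & forall k, `|c k * s ^+ k| <= M.
  have [M [Mr MP]] := cvg_seq_bounded (cvgP _ terms0).
  exists (`|M| + 1); first by rewrite ltr_wpDl.
  move=> k; apply: (MP (`|M| + 1)) => //.
  by rewrite (le_lt_trans (ler_norm _)) // ltrDl.
have head_le (t : R) : 0 < t -> t <= 2^-1 -> `|c 0%N| <= 2 * M * t.
  move=> t0 t2.
  have ts0 : 0 < t * s by rewrite mulr_gt0.
  have tsr : `|t * s| < r.
    rewrite normrM gtr0_norm // (le_lt_trans _ sr) // ler_piMl //.
    by rewrite (le_trans t2) // invf_le1 // ler1n.
  have := cvg0 _ (lt0r_neq0 ts0) tsr; rewrite -cvg_shiftS => lim.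
  (* These differences are minus the partial tails, since the constant term cancels. A bound uniform
     in [N] therefore passes to their limit [c 0]. *)
  have /cvg_norm : (fun N => c 0%N - series (fun k => c k * (t * s) ^+ k) N.+1)
      @ \oo --> c 0%N - 0 by exact: cvgB (cvg_cst _) lim.
  rewrite subr0 => /cvgr_to_le; apply; near=> N.
  rewrite /= series_pseries_recl opprD addNKr normrN seriesEnat /= mulr_sumr.
  apply: le_trans (ler_norm_sum _ _ _) _.
  apply: (@le_trans _ _ (\sum_(0 <= k < N) M * t * t ^+ k)).
    apply: ler_sum => k _.
    rewrite mulrCA -exprS exprMn mulrCA mulrC normrM -mulrA -exprS.
    by rewrite (ger0_norm (exprn_ge0 _ (ltW t0))) ler_wpM2r // exprn_ge0 // ltW.
  rewrite -mulr_sumr mulrC -[leRHS]mulrA ler_wpM2r ?mulr_ge0 ?(ltW M0) ?(ltW t0) //.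
  exact: sum_geometric_le2 (ltW t0) t2.
apply/eqP; rewrite -normr_le0; apply/ler_addgt0Pl => e e0; rewrite addr0.
have M20 : 0 < 2 * M by rewrite mulr_gt0.
(* The first entry makes the geometric bound available, the second gives [2 * M * t <= e]. *)
pose t := Num.min (2^-1) (e / (2 * M)).
have t0 : 0 < t by rewrite lt_min invr_gt0 ltr0n divr_gt0.
apply: le_trans (head_le t t0 _) _; first by rewrite ge_min lexx.
by rewrite mulrC -ler_pdivlMr // ge_min lexx orbT.
Unshelve. all: by end_near. Qed.

(** Once [c 0 = 0], dividing by the nonzero [u] shows that the shifted sequence satisfies the same
    hypothesis, so the induction runs over all sequences [c]. *)
Lemma pseries_eq0_coef c r : 0 < r ->
  (forall u, u != 0 -> `|u| < r ->
    series (fun k => c k * u ^+ k) @ \oo --> (0 : R)) ->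
  forall n, c n = 0.
Proof.
move=> r0 cvg0 n; elim: n c cvg0 => [|n IH] c cvg0.
  exact: pseries_eq0_head r0 cvg0.
apply: (IH (fun k => c k.+1)) => u u0 ur.
have := cvg0 u u0 ur; rewrite -cvg_shiftS => lim.
rewrite (_ : series _ =
    (fun N => u^-1 * series (fun k => c k * u ^+ k) N.+1)); last first.
  apply/funext => N.
  by rewrite series_pseries_recl (pseries_eq0_head _ _ r0 cvg0) add0r mulKf.
by rewrite -[X in _ --> X](mulr0 u^-1); apply: cvgM (cvg_cst _) lim.
Qed.

(** Writing [n / n!] instead of [1 / (n - 1)!] aligns the coefficients with those of the Bernoulli
    series. At [n = 0] the truncated exponent is harmless, because the factor [n] is 0. *)
Lemma series_mul_expR x u :
  series (fun n => n%:R * x ^+ n.-1 / n`!%:R * u ^+ n) @ \oo --> u * expR (u * x).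
Proof.
rewrite -cvg_shiftS (_ : [sequence _]_n =
    (fun N => u * series (exp_coeff (u * x)) N)); last first.
  apply/funext => N.
  rewrite [LHS](series_pseries_recl (fun n => n%:R * x ^+ n.-1 / n`!%:R)) /=.
  rewrite !mul0r add0r; congr (_ * series _ N).
  apply/funext => k; rewrite /exp_coeff /= exprMn factS natrM invfM.
  by rewrite mulrACA divff ?pnatr_eq0 // mul1r mulrC mulrA.
exact: cvgM (cvg_cst _) (is_cvg_series_exp_coeff (u * x)).
Qed.

Lemma bernoulli_polynomials_difference (B : nat -> {poly R}) n x :
  bernoulli_polynomials B ->
  (B n).[x + 1] - (B n).[x] = n%:R * x ^+ n.-1.
Proof.
move=> hB.
(* The coefficient of [u ^ k] in the combined series, whose sum will be shown to be 0 on the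
   punctured disc. *)
pose c k := ((B k).[x + 1] - (B k).[x] - k%:R * x ^+ k.-1) / k`!%:R.
suff : c n = 0.
  move/eqP; rewrite mulf_eq0 invr_eq0 pnatr_eq0 -[n`! == _]negbK -lt0n fact_gt0.
  by rewrite orbF subr_eq0 => /eqP.
apply: (pseries_eq0_coef c (2 * pi)); first by rewrite mulr_gt0 // pi_gt0.
move=> u u0 upi.
have expu1 : expR u - 1 != 0 by rewrite subr_eq0 -expR0 (inj_eq (@expR_inj R)).
rewrite (_ : series _ = (fun N =>
    series (fun k => (B k).[x + 1] * (u ^+ k / k`!%:R)) N -
    series (fun k => (B k).[x] * (u ^+ k / k`!%:R)) N -
    series (fun k => k%:R * x ^+ k.-1 / k`!%:R * u ^+ k) N)); last first.
  apply/funext => N; rewrite !seriesEnat /= -!sumrB; apply: eq_bigr => k _.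
  by rewrite /c !mulrBl [u ^+ k / _]mulrC !mulrA.
rewrite (_ : 0 = u * expR (u * (x + 1)) / (expR u - 1) -
    u * expR (u * x) / (expR u - 1) - u * expR (u * x)); last first.
  rewrite -mulrBl mulrDr mulr1 expRD [X in X / _](_ : _ =
    u * expR (u * x) * (expR u - 1)); last by rewrite mulrBr mulr1 mulrA.
  by rewrite mulfK // subrr.
exact: cvgB (cvgB (hB _ _ u0 upi) (hB _ _ u0 upi)) (series_mul_expR x u).
Qed.

End PowerSeries.

Theorem theorem8 (R : realType) (B : nat -> {poly R})
    (hB : bernoulli_polynomials B) (n m : nat) (hn : (1 <= n)%N) :
  \sum_(d <- divisors n) d%:R * \sum_(0 <= k < m.+1) lyndon R k d =
  ((B n.+1).[m.+1%:R] - bernoulli_number B n.+1) / n.+1%:R.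
Proof.
under eq_bigr do rewrite mulr_sumr.
rewrite exchange_big /=; under eq_bigr do rewrite sum_lyndon //.
apply/(canRL (mulfK _)); first by rewrite pnatr_eq0.
(* The Bernoulli number, seen as the value at [0%:R], is the lower end of the telescoping sum over
   [0 <= k < m.+1]. *)
rewrite mulr_suml -[bernoulli_number _ _]/((B n.+1).[0%:R]).
rewrite -(telescope_sumr (fun k => (B n.+1).[k%:R])) //.
apply: eq_bigr => k _.
by rewrite -[k.+1]addn1 natrD bernoulli_polynomials_difference // mulrC.
Qed.
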